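(* Let $k\ge 2$ be any integer and let $R(k)=\sum_{r=1}^{k}|\mathcal{P}_k(r,k)|$. Then $$R(k)=M_2(k)=\frac{1}{k}\sum_{s\mid k}2^{k/s}\mu(s),$$ where the sum ranges over all positive divisors $s$ of $k$.
   Context: For a finite set $A$ of nonnegative integers and a positive integer $i$, let $\overline{A}(i)\subseteq\{0,1,\ldots,i-1\}$ be the set of residues modulo $i$ of the elements of $A$; two finite sets $A,B$ are called equal modulo $i$ if $\overline{A}(i)=\overline{B}(i)$. Write $A+t=\{a+t: a\in A\}$. For integers $1\le j\le i$, $\mathcal{A}(j,i)$ denotes the collection of all subsets of $\{0,1,\ldots,i-1\}$ with exactly $j$ elements. For $A\in\mathcal{A}(j,i)$, $f_i(A)$ denotes the smallest positive integer $l$ such that $A$ equals $A+l$ modulo $i$ (it exists and is at most $i$). For $1\le s\le i$, $\mathcal{A}_s(j,i)=\{A\in\mathcal{A}(j,i): f_i(A)=s\}$. Two sets $A,A'\in\mathcal{A}_k(r,k)$ are called $k$-equivalent if there exists $j\in\{0,1,\ldots,k-1\}$ such that $A+j$ equals $A'$ modulo $k$; this is an equivalence relation, and $\mathcal{P}_k(r,k)$ denotes the set of its equivalence classes in $\mathcal{A}_k(r,k)$ (empty if $\mathcal{A}_k(r,k)$ is empty). $\mu$ is the Möbius function and $|\cdot|$ denotes cardinality. $M_2(k)$ is the binary case of Moreau's necklace-counting function, i.e. by definition $M_2(k)=\frac1k\sum_{s\mid k}\mu(s)2^{k/s}$. *)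

(* Defs.v *)
From HB Require Import structures.
From mathcomp Require Import all_boot all_order all_algebra.
From mathcomp Require Import finmap.

Set Implicit Arguments.
Unset Strict Implicit.
Unset Printing Implicit Defensive.

Import GRing.Theory.

Local Open Scope fset_scope.
Local Open Scope nat_scope.

Definition residues (i : nat) (A : {fset nat}) : {fset nat} :=
  [fset a %% i | a in A].

Definition eqmodset (i : nat) (A B : {fset nat}) : bool :=
  residues i A == residues i B.

Definition shift (A : {fset nat}) (t : nat) : {fset nat} :=
  [fset a + t | a in A].

Definition subsets (j i : nat) : {fset {fset nat}} :=
  [fset A in fpowerset [fset x in iota 0 i] | #|` A| == j].

(* The search may stop at i because A and A + i are always equal modulo i;
   see period_min. The default value 0 is only reached when i = 0. *)
Definition period (i : nat) (A : {fset nat}) : nat :=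
  head 0 [seq l <- iota 1 i | eqmodset i A (shift A l)].

Lemma eqmodset_shift_modulus (i : nat) (A : {fset nat}) :
  eqmodset i A (shift A i).
Proof.
apply/eqP/fsetP => x; apply/imfsetP/imfsetP => /= -[a aA ->].
  by exists (a + i); [apply/imfsetP; exists a | rewrite modnDr].
by case/imfsetP: aA => b /= bA ->; exists b; rewrite // modnDr.
Qed.

Lemma period_min (i : nat) (A : {fset nat}) : 0 < i ->
  [/\ 0 < period i A <= i, eqmodset i A (shift A (period i A))
    & forall l, 0 < l -> eqmodset i A (shift A l) -> period i A <= l].
Proof.
move=> i_gt0; rewrite /period; set P := fun l => eqmodset i A (shift A l).
set s := filter _ _.
have i_s : i \in s.
  by rewrite mem_filter /P eqmodset_shift_modulus mem_iota i_gt0 add1n /=.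
have srt : sorted leq s by rewrite sorted_filter ?iota_sorted //; exact: leq_trans.
have min_s l : l \in s -> head 0 s <= l.
  case: (s) srt => [|x s'] //= ps; rewrite inE => /predU1P[-> //|ls'].
  by move: ps; rewrite (path_sortedE leq_trans) => /andP[/allP/(_ _ ls')].
have head_s : head 0 s \in s by case: (s) i_s => [|x s' _] //=; rewrite mem_head.
split; first 1 last.
- by move: head_s; rewrite mem_filter => /andP[].
- move=> l l_gt0 Pl; have [li|/ltnW il] := leqP l i.
    by apply: min_s; rewrite mem_filter /P Pl mem_iota l_gt0 add1n ltnS.
  exact: leq_trans (min_s _ i_s) il.
by rewrite min_s // andbT; move: head_s; rewrite mem_filter mem_iota => /and3P[].
Qed.

Definition subsets_period (s j i : nat) : {fset {fset nat}} :=
  [fset A in subsets j i | period i A == s].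

Definition kequiv (k : nat) (A B : {fset nat}) : bool :=
  [exists j : 'I_k, eqmodset k (shift A j) B].

Definition classes (r k : nat) : {fset {fset {fset nat}}} :=
  [fset [fset B in subsets_period k r k | kequiv k A B]
     | A in subsets_period k r k].

Definition Rcount (k : nat) : nat :=
  \sum_(1 <= r < k.+1) #|` classes r k|.

Local Open Scope ring_scope.

(* mobius 0 = 1 is a junk value. *)
Definition mobius (n : nat) : int :=
  if has (fun p => (p ^ 2 %| n)%N) (primes n) then 0
  else (-1) ^+ size (primes n).

Definition moreau2 (k : nat) : rat :=
  k%:R^-1 * \sum_(s <- divisors k) (mobius s)%:~R * 2 ^+ (k %/ s).

(* Main.v *)
(* The cyclic group of order k acts on the subsets of {0, ..., k-1} by
   translation, and the orbits of sets with period k have exactly k elements,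
   so k * R(k) is the number N of subsets with period k (of any size). A set is
   fixed by translation by t iff its period divides t, and 2 ^ d subsets are
   fixed by translation by a divisor d of k. Since the sum of mu(s) over
   s | k / period(A) is 1 if period(A) = k and 0 otherwise, and these s are the
   divisors of k for which k / s fixes A, exchanging sums gives
   N = sum_(s | k) mu(s) 2 ^ (k / s). *)
Require Import Defs.
From HB Require Import structures.
From mathcomp Require Import all_boot all_order all_algebra.
From mathcomp Require Import finmap.

Local Open Scope ring_scope.

Import GRing.Theory Num.Theory.

(** * The Möbius function and its divisor sums *)

Lemma mobius_primeM (p t : nat) : prime p -> (0 < t)%N -> ~~ (p %| t)%N ->
  mobius (p * t) = - mobius t.
Proof.
move=> p_pr t_gt0 pNt; have p_gt0 := prime_gt0 p_pr.
have pE : perm_eq (primes (p * t)) (p :: primes t).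
  apply: uniq_perm; rewrite /= ?primes_uniq //.
    by rewrite mem_primes p_pr t_gt0 (negPf pNt).
  by move=> q; rewrite primesM // primes_prime // !inE.
rewrite /mobius (perm_has _ pE) (perm_size pE) /=.
have -> : (p ^ 2 %| p * t)%N = false.
  by rewrite expnS expn1 dvdn_pmul2l // (negPf pNt).
rewrite (_ : has (fun q => q ^ 2 %| p * t)%N (primes t)
           = has (fun q => q ^ 2 %| t)%N (primes t)); last first.
  apply: eq_in_has => q; rewrite mem_primes => /and3P[q_pr _ qt].
  rewrite Gauss_dvdr // coprimeXl // prime_coprime // dvdn_prime2 //.
  by apply: contraNneq pNt => <-.
by case: ifP => /= hs; rewrite hs ?oppr0 // exprS mulN1r.
Qed.

Lemma mobius_sqr_dvd (p n : nat) : prime p -> (0 < n)%N -> (p ^ 2 %| n)%N ->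
  mobius n = 0.
Proof.
move=> p_pr n_gt0 pn; rewrite /mobius ifT //; apply/hasP; exists p => //.
by rewrite mem_primes p_pr n_gt0 (dvdn_trans _ pn) // dvdn_exp.
Qed.

(* For a prime p dividing n, the squarefree divisors of n pair off as t and
   p * t with p not dividing t, and their contributions cancel. *)
Lemma sum_mobius_divisors (n : nat) : (0 < n)%N ->
  \sum_(s <- divisors n) mobius s = (n == 1)%N%:R.
Proof.
move=> n_gt0; have [->|n_neq1] := eqVneq n 1.
  by rewrite (_ : divisors 1 = [:: 1%N]) // big_seq1 /mobius.
have n_gt1 : (1 < n)%N by case: n n_gt0 n_neq1 => [|[]].
have [p p_pr pn] : exists2 p, prime p & (p %| n)%N.
  by exists (pdiv n); [apply: pdiv_prime | apply: pdiv_dvd].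
have p_gt0 := prime_gt0 p_pr.
rewrite (bigID (fun s => p %| s)%N) /= -big_filter.
have mulp_inj : injective (muln p).
  by move=> a b /eqP; rewrite eqn_pmul2l // => /eqP.
(* Among the multiples of [p], those divisible by [p ^ 2] have [mobius] zero and drop out; the
   others are [p * t] with [p] not dividing [t]. *)
rewrite big_seq (bigID (fun s => ~~ (p ^ 2 %| s))%N) /=.
rewrite [X in _ + X + _]big1 ?addr0; last first.
  move=> s; rewrite mem_filter -dvdn_divisors // negbK.
  by case/andP=> /andP[_ sn]; apply: mobius_sqr_dvd => //; apply: dvdn_gt0 sn.
rewrite -big_seq_cond -big_filter.
rewrite (perm_big [seq (p * t)%N | t <- divisors n & ~~ (p %| t)%N]) /=.
  rewrite big_map big_filter -[X in _ + X]big_filter big_filter.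
  rewrite big_seq_cond [X in _ + X]big_seq_cond -big_split big1 //= => t.
  rewrite -dvdn_divisors // => /andP[tn pNt].
  by rewrite mobius_primeM ?addNr // (dvdn_gt0 n_gt0).
apply: uniq_perm.
- by rewrite !filter_uniq ?divisors_uniq.
- by rewrite map_inj_uniq // filter_uniq ?divisors_uniq.
move=> s; rewrite !mem_filter -dvdn_divisors //.
apply/and3P/mapP => [[p2Ns /dvdnP[t sE]]|[t]].
  rewrite sE mulnC in p2Ns * => sn; exists t => //.
  rewrite mem_filter -dvdn_divisors // (dvdn_trans _ sn) ?dvdn_mull // andbT.
  by move: p2Ns; rewrite expnS expn1 dvdn_pmul2l.
rewrite mem_filter -dvdn_divisors // => /andP[pNt tn] ->.
rewrite expnS expn1 dvdn_pmul2l // dvdn_mulr // Gauss_dvd ?pn //.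
by rewrite prime_coprime.
Qed.

(** * Translations modulo k acting on subsets of {0, ..., k-1} *)

Local Open Scope fset_scope.
Local Open Scope nat_scope.

(** Reducing the translate back to residues makes translation an action on subsets of {0, ..., k-1},
    so that equality modulo [k] becomes equality of sets. *)
Definition rotmod (k t : nat) (A : {fset nat}) : {fset nat} :=
  residues k (shift A t).

Lemma below_ltn (k : nat) (A : {fset nat}) :
  reflect (forall x, x \in A -> x < k) (A `<=` [fset x in iota 0 k]).
Proof.
apply: (iffP idP) => [/fsubsetP Ak x /Ak|Ak]; first by rewrite !inE mem_iota.
by apply/fsubsetP => x /Ak; rewrite !inE mem_iota.
Qed.

Lemma residues_id (k : nat) (A : {fset nat}) :
  A `<=` [fset x in iota 0 k] -> residues k A = A.
Proof.
move=> /below_ltn Ak; apply/fsetP => x; apply/imfsetP/idP => [[a aA ->]|xA].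
  by rewrite modn_small ?Ak.
by exists x; rewrite ?modn_small ?Ak.
Qed.

Lemma rotmod_below (k t : nat) (A : {fset nat}) : 0 < k ->
  rotmod k t A `<=` [fset x in iota 0 k].
Proof.
by move=> k_gt0; apply/below_ltn => x /imfsetP[a _ ->]; rewrite ltn_mod.
Qed.

(** Testing [x %% k] for every [x], instead of every [x < k], lets translated residues be rewritten
    without side conditions. *)
Lemma eq_below (k : nat) (A B : {fset nat}) :
    A `<=` [fset x in iota 0 k] -> B `<=` [fset x in iota 0 k] ->
  (forall x, (x %% k \in A) = (x %% k \in B)) -> A = B.
Proof.
move=> /below_ltn Ak /below_ltn Bk AB; apply/fsetP => x.
have [xk|kx] := ltnP x k; first by rewrite -(modn_small xk) AB.
by apply/idP/idP => [/Ak|/Bk]; rewrite ltnNge kx.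
Qed.

Lemma mem_rotmod (k t x : nat) (A : {fset nat}) : A `<=` [fset x in iota 0 k] ->
  ((x + t) %% k \in rotmod k t A) = (x %% k \in A).
Proof.
move=> /below_ltn Ak; apply/imfsetP/idP => [[b /imfsetP[a aA ->] /eqP]|xA].
  by rewrite eqn_modDr => /eqP ->; rewrite modn_small ?Ak.
by exists (x %% k + t); rewrite ?modnDml //; apply/imfsetP; exists (x %% k).
Qed.

(* t * k.-1 stands for - t modulo k. *)
Lemma modnDcompl (k t x : nat) : 0 < k -> (x + t * k.-1 + t) %% k = x %% k.
Proof. by move=> k_gt0; rewrite -addnA -mulnSr prednK // addnC modnMDl. Qed.

Lemma rotmodD (k s t : nat) (A : {fset nat}) : 0 < k ->
  A `<=` [fset x in iota 0 k] ->
  rotmod k t (rotmod k s A) = rotmod k (s + t) A.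
Proof.
move=> k_gt0 Ak; apply: (eq_below k); rewrite ?rotmod_below // => x.
(* Writing the residue as [y + (s + t)] modulo [k] reduces both sides to membership of [y %% k] in
   [A]. *)
rewrite -(modnDcompl k (s + t)) // mem_rotmod // addnA.
by rewrite mem_rotmod ?rotmod_below // mem_rotmod.
Qed.

Lemma rotmod_modn (k t : nat) (A : {fset nat}) :
  rotmod k (t %% k) A = rotmod k t A.
Proof.
apply/fsetP => x; apply/imfsetP/imfsetP => /= -[_ /imfsetP[a aA ->] ->].
  by exists (a + t); rewrite ?modnDmr //; apply/imfsetP; exists a.
by exists (a + t %% k); rewrite ?modnDmr //; apply/imfsetP; exists a.
Qed.

Lemma rotmod_multiple (k t : nat) (A : {fset nat}) :
  A `<=` [fset x in iota 0 k] -> k %| t -> rotmod k t A = A.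
Proof.
move=> Ak kt; rewrite -rotmod_modn (eqP kt) -[RHS](residues_id k) //.
congr residues; apply/fsetP => x; apply/imfsetP/idP => [[a aA ->]|xA].
  by rewrite addn0.
by exists x; rewrite ?addn0.
Qed.

Lemma rotmod_inj (k t : nat) (A B : {fset nat}) : 0 < k ->
    A `<=` [fset x in iota 0 k] -> B `<=` [fset x in iota 0 k] ->
  rotmod k t A = rotmod k t B -> A = B.
Proof.
by move=> k_gt0 Ak Bk eqAB; apply: (eq_below k) => // x;
  rewrite -(mem_rotmod k t) // eqAB mem_rotmod.
Qed.

Lemma card_rotmod (k t : nat) (A : {fset nat}) :
  A `<=` [fset x in iota 0 k] -> #|` rotmod k t A| = #|` A|.
Proof.
move=> /below_ltn Ak; rewrite card_in_imfset /=; last first.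
  move=> _ _ /imfsetP[a /= aA ->] /imfsetP[b /= bA ->] /eqP.
  by rewrite eqn_modDr !modn_small ?Ak // => /eqP ->.
by rewrite card_imfset //; apply: addIn.
Qed.

(** * Periods and the sets fixed by a translation *)

Lemma eqmodset_rotmod (k t : nat) (A : {fset nat}) :
  A `<=` [fset x in iota 0 k] -> eqmodset k A (shift A t) = (rotmod k t A == A).
Proof. by move=> Ak; rewrite /eqmodset (residues_id k A Ak) eq_sym. Qed.

Lemma rotmod_fixedP (k t : nat) (A : {fset nat}) : 0 < k ->
    A `<=` [fset x in iota 0 k] ->
  reflect (forall x, ((x + t) %% k \in A) = (x %% k \in A)) (rotmod k t A == A).
Proof.
move=> k_gt0 Ak; apply: (iffP eqP) => [At x|At].
  by rewrite -[in LHS]At mem_rotmod.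
apply: (eq_below k); rewrite ?rotmod_below // => x.
by rewrite -(modnDcompl k t) // mem_rotmod // At.
Qed.

(** Multiples of the period fix [A], so if [t] fixes [A], its remainder modulo the period does too;
    minimality of the period forces that remainder to be zero. *)
Lemma period_dvdn (k t : nat) (A : {fset nat}) : 0 < k ->
  A `<=` [fset x in iota 0 k] -> (period k A %| t) = (rotmod k t A == A).
Proof.
move=> k_gt0 Ak; have [/andP[p_gt0 _] pA pmin] := period_min A k_gt0.
set p := period k A in p_gt0 pA pmin *; rewrite eqmodset_rotmod // in pA.
have fix_mul m : rotmod k (m * p) A = A.
  elim: m => [|m IHm]; first by rewrite mul0n rotmod_multiple ?dvdn0.
  by rewrite mulSn -rotmodD // (eqP pA).
apply/idP/idP => [/dvdnP[m ->]|tA]; first by rewrite fix_mul.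
rewrite /dvdn -leqn0 leqNgt; apply/negP => r_gt0.
have: rotmod k (t %% p) A == A.
  by rewrite -[X in rotmod _ _ X](fix_mul (t %/ p)) rotmodD // -divn_eq.
rewrite -eqmodset_rotmod // => /(pmin _ r_gt0).
by rewrite leqNgt ltn_mod p_gt0.
Qed.

Lemma period_dvd_modulus (k : nat) (A : {fset nat}) : 0 < k ->
  A `<=` [fset x in iota 0 k] -> period k A %| k.
Proof. by move=> k_gt0 Ak; rewrite period_dvdn ?rotmod_multiple. Qed.

(** Translations commute and are injective, so the same shifts fix [A] and its translate; the two
    periods then divide each other. *)
Lemma period_rotmod (k t : nat) (A : {fset nat}) : 0 < k ->
  A `<=` [fset x in iota 0 k] -> period k (rotmod k t A) = period k A.
Proof.
move=> k_gt0 Ak; have Rk := rotmod_below k t A k_gt0.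
have dvdE s : (period k (rotmod k t A) %| s) = (period k A %| s).
  rewrite !period_dvdn // rotmodD // addnC -rotmodD //.
  by apply/eqP/eqP => [|-> //]; apply: rotmod_inj; rewrite ?rotmod_below.
by apply/eqP; rewrite eqn_dvd dvdE dvdnn -dvdE dvdnn.
Qed.

(** As [d] divides [k], reduction modulo [d] is well defined on residues modulo [k], and the fixed
    sets are exactly the preimages of subsets of {0, ..., d-1}. *)
Lemma card_rotmod_fixed (k d : nat) : 0 < k -> d %| k ->
  #|` [fset A in fpowerset [fset x in iota 0 k] | rotmod k d A == A]| = 2 ^ d.
Proof.
move=> k_gt0 dk; have d_gt0 := dvdn_gt0 k_gt0 dk.
pose lift (B : {fset nat}) := [fset x in iota 0 k | x %% d \in B].
have liftE B x : x %% k \in lift B = (x %% d \in B).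
  by rewrite !inE mem_iota ltn_mod k_gt0 modn_dvdm.
have lift_below B : lift B `<=` [fset x in iota 0 k].
  by apply/below_ltn => x; rewrite !inE mem_iota => /andP[].
have -> : [fset A in fpowerset [fset x in iota 0 k] | rotmod k d A == A]
        = [fset lift B | B in fpowerset [fset x in iota 0 d]].
  apply/fsetP => A; rewrite !inE /= fpowersetE.
  apply/andP/imfsetP => /= [[Ak /(rotmod_fixedP _ _ _ k_gt0 Ak) Ad]|[B]].
    (* The part of [A] below [d] determines [A]: invariance under [d] lowers the quotient [x %/ d]
       one unit at a time. *)
    exists [fset x in A | x < d].
      by rewrite fpowersetE; apply/below_ltn => x; rewrite !inE => /andP[].
    apply: (eq_below k) => // x; rewrite liftE !inE /= ltn_mod d_gt0 andbT.
    rewrite {1}(divn_eq x d); elim: (x %/ d) => [|m IHm].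
      by rewrite mul0n add0n modn_small // (leq_trans _ (dvdn_leq k_gt0 dk))
        // ltn_mod.
    by rewrite mulSn addnC addnCA addnC Ad addnC.
  rewrite fpowersetE => Bd ->; split=> //.
  by apply/rotmod_fixedP => // x; rewrite !liftE modnDr.
rewrite card_in_imfset /=; last first.
  move=> B C; rewrite !fpowersetE => Bd Cd eqBC.
  by apply: (eq_below d) => // x; rewrite -!liftE eqBC.
by rewrite card_fpowerset card_imfset //= undup_id ?iota_uniq ?size_iota.
Qed.

(** * Equivalence classes as orbits of size k *)

Lemma in_fset_sep (T : choiceType) (S : {fset T}) (P : pred T) (x : T) :
  (x \in [fset y in S | P y]) = (x \in S) && P x.
Proof. by rewrite !inE. Qed.

Lemma mem_subsets_period (s j i : nat) (A : {fset nat}) :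
  (A \in subsets_period s j i) =
  [&& A `<=` [fset x in iota 0 i], #|` A| == j & period i A == s].
Proof. by rewrite !inE /= fpowersetE andbA. Qed.

Lemma kequivP (k : nat) (A B : {fset nat}) : 0 < k ->
    B `<=` [fset x in iota 0 k] ->
  reflect (exists t, B = rotmod k t A) (kequiv k A B).
Proof.
move=> k_gt0 Bk; apply: (iffP existsP) => [[j]|[t Bt]].
  by rewrite /eqmodset (residues_id _ _ Bk) => /eqP <-; exists j.
exists (Ordinal (ltn_pmod t k_gt0)).
by rewrite /eqmodset (residues_id _ _ Bk) Bt; apply/eqP/rotmod_modn.
Qed.

Lemma subsets_period_rotmod (k r t : nat) (A : {fset nat}) : 0 < k ->
  A \in subsets_period k r k -> rotmod k t A \in subsets_period k r k.
Proof.
move=> k_gt0; rewrite !mem_subsets_period => /and3P[Ak cA pA].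
by rewrite rotmod_below // card_rotmod // period_rotmod // cA.
Qed.

(** The class is the orbit of [A], and the action on it is free: if shifts [s <= t < k] agree on
    [A], then [t - s] fixes [A], so the period [k] divides [t - s] and [s = t]. *)
Lemma card_kequiv_class (k r : nat) (A : {fset nat}) : 0 < k ->
    A \in subsets_period k r k ->
  #|` [fset B in subsets_period k r k | kequiv k A B]| = k.
Proof.
move=> k_gt0 AS; have := AS; rewrite mem_subsets_period => /and3P[Ak _ /eqP pA].
have -> : [fset B in subsets_period k r k | kequiv k A B]
        = [fset rotmod k t A | t in iota 0 k].
  apply/fsetP => B; rewrite in_fset_sep.
  apply/andP/imfsetP => /= [[BS]|[t _ ->]].
    move: (BS); rewrite mem_subsets_period => /and3P[Bk _ _].
    case/(kequivP _ _ _ k_gt0 Bk) => t ->.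
    exists (t %% k); rewrite ?rotmod_modn //.
    by rewrite mem_iota ltn_mod.
  split; first exact: subsets_period_rotmod.
  by apply/kequivP; rewrite ?rotmod_below //; exists t.
rewrite card_in_imfset /= ?undup_id ?iota_uniq ?size_iota //.
move=> s t; rewrite !mem_iota !add0n => /= sk tk.
wlog st : s t sk tk / s <= t => [W|].
  by have [/W|/ltnW/W W' /esym] := leqP s t; [exact | move/W' ->].
rewrite -{1}(subnK st) -rotmodD // => /esym/rotmod_inj; rewrite ?rotmod_below // => H.
have: period k A %| t - s by rewrite period_dvdn // H.
rewrite pA => /dvdn_leq; rewrite subn_gt0 [k <= _]leqNgt.
rewrite (leq_ltn_trans (leq_subr _ _) tk).
by case: ltngtP st => // _ _ /(_ isT).
Qed.

(** The map sending a set to its class partitions the sets of period [k] into fibres; each fibre is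
    itself a class, hence has [k] elements. *)
Lemma card_classes (k r : nat) : 0 < k ->
  #|` classes r k| * k = #|` subsets_period k r k|.
Proof.
move=> k_gt0.
pose cl A := [fset B in subsets_period k r k | kequiv k A B].
rewrite [RHS]card_fset_sum1 (partition_big_imfset _ cl) /= -/(classes r k).
rewrite [in LHS]card_fset_sum1 big_distrl /= big_seq [RHS]big_seq.
apply: eq_bigr => _ /imfsetP[/= A AS ->]; rewrite -/(cl A) mul1n.
have := AS; rewrite mem_subsets_period => /and3P[Ak _ _].
rewrite -[LHS](card_kequiv_class k r A) // card_fset_sum1.
rewrite [RHS]big_fset_condE; apply: eq_fbigl => B.
rewrite in_fset_sep [RHS]in_fset_sep.
have [BS|//] := boolP (B \in subsets_period k r k).
have := BS; rewrite mem_subsets_period => /and3P[Bk _ _] /=.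
have kequivxx C : C \in subsets_period k r k -> kequiv k C C.
  rewrite mem_subsets_period => /and3P[Ck _ _].
  by apply/kequivP => //; exists 0; rewrite rotmod_multiple ?dvdn0.
apply/idP/eqP => [/kequivP[]// t BE|]; last first.
  by move=> /fsetP/(_ B); rewrite in_fset_sep [RHS]in_fset_sep BS kequivxx.
apply/fsetP => C; rewrite in_fset_sep [RHS]in_fset_sep; apply: andb_id2l.
rewrite mem_subsets_period => /and3P[Ck _ _].
apply/kequivP/kequivP => // -[s ->].
  by exists (t + s); rewrite BE rotmodD.
(* The shift [t * k.-1] brings [B] back to [A], after which [s] leads to the target. *)
exists (t * k.-1 + s); rewrite BE rotmodD // addnA -mulnS prednK //.
by rewrite -[RHS]rotmod_modn modnMDl rotmod_modn.
Qed.

(** * Möbius inversion and the final count *)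

Lemma sum_mobius_rotmod_fixed (k : nat) (A : {fset nat}) : 0 < k ->
    A `<=` [fset x in iota 0 k] ->
  ((period k A == k)%:R =
     \sum_(s <- divisors k | rotmod k (k %/ s) A == A) mobius s :> int)%R.
Proof.
move=> k_gt0 Ak; have pk := period_dvd_modulus k A k_gt0 Ak.
have [/andP[p_gt0 _] _ _] := period_min A k_gt0.
have q_gt0 : 0 < k %/ period k A by rewrite divn_gt0 //; apply: dvdn_leq.
have -> : (period k A == k) = (k %/ period k A == 1).
  by rewrite -[RHS](eqn_pmul2r p_gt0) mul1n divnK // eq_sym.
rewrite -sum_mobius_divisors // -[RHS]big_filter; apply: perm_big.
apply: uniq_perm; rewrite ?filter_uniq ?divisors_uniq // => s.
rewrite mem_filter -!dvdn_divisors // -period_dvdn //.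
(* Both conditions say that [s] times the period divides [k]. *)
apply/idP/andP => [sq|[psk sk]].
  have sk : s %| k := dvdn_trans sq (dvdn_div pk).
  by rewrite dvdn_divRL // mulnC -dvdn_divRL.
by rewrite dvdn_divRL // mulnC -dvdn_divRL.
Qed.

Lemma card_full_period (k : nat) : 0 < k ->
  (#|` [fset A in fpowerset [fset x in iota 0 k] | period k A == k]|%:R =
     \sum_(s <- divisors k) mobius s * 2 ^+ (k %/ s) :> int)%R.
Proof.
move=> k_gt0; rewrite card_fset_sum1 -big_fset_condE big_mkcond natr_sum /=.
transitivity (\sum_(A <- fpowerset [fset x in iota 0 k])
  \sum_(s <- divisors k | rotmod k (k %/ s) A == A) mobius s)%R.
  rewrite big_seq [RHS]big_seq; apply: eq_bigr => A; rewrite fpowersetE => Ak.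
  by rewrite -sum_mobius_rotmod_fixed //; case: eqP.
under [LHS]eq_bigr do rewrite big_mkcond.
(* For fixed [s], the inner sum is [mobius s] times the number of sets fixed by [k %/ s]. *)
rewrite exchange_big /= big_seq [RHS]big_seq; apply: eq_bigr => s.
rewrite -dvdn_divisors // => sk; rewrite -big_mkcond /= big_fset_condE.
rewrite big_const_seq count_predT iter_addr_0 card_rotmod_fixed ?dvdn_div //.
by rewrite -[LHS]mulr_natr natrX.
Qed.

Lemma Rcount_mul (k : nat) : 1 < k ->
  Rcount k * k =
    #|` [fset A in fpowerset [fset x in iota 0 k] | period k A == k]|.
Proof.
move=> k_gt1; have k_gt0 := ltnW k_gt1.
pose X := [fset A in fpowerset [fset x in iota 0 k] | period k A == k].
(* [Rcount] omits size 0. This loses nothing, since the empty set has period 1, which differs from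
   [k] because [k > 1]. *)
have period0 : period k fset0 != k.
  suff: period k fset0 %| 1.
    by rewrite dvdn1 => /eqP ->; rewrite eq_sym gtn_eqF.
  by rewrite period_dvdn ?fsub0set //; apply/rotmod_fixedP; rewrite ?fsub0set.
rewrite /Rcount big_distrl /=.
transitivity (\sum_(r < k.+1) \sum_(A <- X | #|` A| == r) 1).
  rewrite [RHS](big_ord_recl k) [X in _ = X + _]big1_seq ?add0n => [|A];
    last first.
    rewrite cardfs_eq0 in_fset_sep => /andP[/eqP -> /andP[_]].
    by rewrite (negPf period0).
  rewrite big_add1 /= big_mkord; apply: eq_bigr => r _.
  rewrite card_classes // card_fset_sum1 [RHS]big_fset_condE.
  apply: eq_fbigl => A; rewrite mem_subsets_period in_fset_sep in_fset_sep.
  by rewrite fpowersetE andbA andbAC.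
rewrite card_fset_sum1 -/X [RHS]big_seq.
(* Sizes are at most [k], so [inord] in ['I_k.+1] keeps them unchanged. *)
rewrite [RHS](partition_big (fun A => inord #|` A| : 'I_k.+1) xpredT) //=.
apply: eq_bigr => r _; rewrite big_seq_cond; apply: eq_bigl => A.
have [|//] := boolP (A \in X); rewrite in_fset_sep fpowersetE => /andP[Ak _] /=.
rewrite -val_eqE /= inordK // ltnS (leq_trans (fsubset_leq_card Ak)) //.
by rewrite card_imfset //= undup_id ?iota_uniq ?size_iota.
Qed.

Local Open Scope ring_scope.

Theorem theorem3 (k : nat) (hk : (2 <= k)%N) :
  (Rcount k)%:R = moreau2 k
  /\ moreau2 k =
     k%:R^-1 * \sum_(s <- divisors k) 2 ^+ (k %/ s) * (mobius s)%:~R.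
Proof.
split; last by congr (_ * _); apply: eq_bigr => s _; rewrite mulrC.
have k_neq0 : k%:R != 0 :> rat by rewrite pnatr_eq0 -lt0n ltnW.
apply: (mulIf k_neq0); rewrite -natrM Rcount_mul // /moreau2 mulrAC mulVf //.
(* The cast to [rat] is factored through [int], where the Möbius count is stated. *)
rewrite mul1r [LHS]pmulrn -natz card_full_period ?(ltnW hk) //.
by rewrite rmorph_sum; apply: eq_bigr => s _; rewrite rmorphM rmorphXn.
Qed.
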